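(* Let $s\in I(\Phi)$ and $\sigma_1,\sigma_2\in\mathrm{Inv}^\tau_s(\mathfrak g_{\mathbb R},\mathfrak h_{\mathbb R})$. If $\Phi^{\sigma_1}_\bullet=\Phi^{\sigma_2}_\bullet$, then there is a complex Lie algebra automorphism $\varphi$ of $\mathfrak g$ with $\varphi(\mathfrak h)=\mathfrak h$, $\varphi(\mathfrak h_s)=\mathfrak h_s$ and $\varphi(\mathfrak g_{\sigma_2})=\mathfrak g_{\sigma_1}$.
   Context: $\mathfrak g$ is a complex semisimple Lie algebra, $\mathfrak h$ a Cartan subalgebra, $\Phi=\Phi(\mathfrak g,\mathfrak h)$, $\mathfrak h_{\mathbb R}=\{H\in\mathfrak h:\alpha(H)\in\mathbb R\ \forall\alpha\}$; the Killing form gives an inner product on $V=\mathfrak h_{\mathbb R}^*$ in which $\Phi$ is a root system; $I(\Phi)$ is the set of orthogonal involutions of $V$ preserving $\Phi$. For $s\in I(\Phi)$: $\Phi^s_\bullet=\{\alpha:s\alpha=-\alpha\}$; $s^*$ is the dual involution of $\mathfrak h_{\mathbb R}$, $\mathfrak h^\pm_s=\{H:s^*H=\pm H\}$, $\mathfrak h_s=\mathfrak h^+_s\oplus i\mathfrak h^-_s$. Fix a Chevalley system $\{(X_\alpha,H_\alpha)\}$: $X_\alpha\in\mathfrak g^\alpha$, $H_\alpha\in\mathfrak h_{\mathbb R}$, $\alpha(H_\beta)\in\mathbb Z$, $[X_\alpha,X_{-\alpha}]=-H_\alpha$, $[H_\alpha,X_{\pm\alpha}]=\pm2X_{\pm\alpha}$,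 with $\mathfrak g_{\mathbb R}=\mathfrak h_{\mathbb R}\oplus\bigoplus_\alpha\mathbb RX_\alpha$ a split real form and $\tau$ ($\tau|_{\mathfrak h_{\mathbb R}}=-\mathrm{id}$, $\tau X_\alpha=X_{-\alpha}$) an involutive automorphism of $\mathfrak g_{\mathbb R}$; $\mathfrak g_u=\{X\in\mathfrak g_{\mathbb R}:\tau X=X\}\oplus i\{X\in\mathfrak g_{\mathbb R}:\tau X=-X\}$. Automorphisms of $\mathfrak g_{\mathbb R}$ are extended anti-$\mathbb C$-linearly to $\mathfrak g$. $\mathrm{Inv}^\tau(\mathfrak g_{\mathbb R},\mathfrak h_{\mathbb R})$ is the set of involutive automorphisms $\sigma$ of $\mathfrak g_{\mathbb R}$ with $\sigma(\mathfrak h_{\mathbb R})=\mathfrak h_{\mathbb R}$, $\sigma(\mathfrak g_u)=\mathfrak g_u$; $\rho(\sigma)$ is $\alpha\mapsto\alpha\circ\sigma^{-1}|_{\mathfrak h_{\mathbb R}}$; $\mathrm{Inv}^\tau_s=\{\sigma:\rho(\sigma)=s\}$; $\mathfrak g_\sigma=\{X\in\mathfrak g_{\mathbb R}:\sigma X=X\}\oplus i\{X\in\mathfrak g_{\mathbb R}:\sigma X=-X\}$. For $\sigma\in\mathrm{Inv}^\tau_s$ and $\alpha\in\Phi^s_\bullet$ one has $\sigma(X_\alpha)=\pm X_{-\alpha}$; $\Phi^\sigma_\bullet$ (compact imaginary roots) is the set of $\alpha\in\Phi^s_\bullet$ with $\sigma(X_\alpha)=X_{-\alpha}$. *)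

(* Defs.v *)
From HB Require Import structures.
From mathcomp Require Import all_boot all_order all_algebra.
From mathcomp Require Import reals complex.
Set Implicit Arguments. Unset Strict Implicit. Unset Printing Implicit Defensive.
Import Order.TTheory GRing.Theory Num.Theory.
Local Open Scope ring_scope.

(* Coordinates.  The split real form g_R = h_R (+) (+)_alpha R X_alpha is     *)
(* realised as 'rV[R]_(l + m): the first l coordinates are coordinates in a  *)
(* fixed basis of h_R, the last m coordinates are the coefficients on the    *)
(* Chevalley vectors X_alpha, alpha ranging over Phi indexed by 'I_m.         *)
(* The complex Lie algebra g = g_R (x) C is 'rV[R[i]]_(l + m).               *)
(* Linear maps act on row vectors on the right: x |-> x *m A.               *)

(* Lie bracket given by structure constants c j k = [e_j, e_k]. *)
Definition lie_br (K : comNzRingType) (N : nat) (c : 'I_N -> 'I_N -> 'rV[K]_N)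
  (x y : 'rV[K]_N) : 'rV[K]_N :=
  \sum_(j < N) \sum_(k < N) (x 0 j * y 0 k) *: c j k.

(* Matrix of ad x acting on row vectors: v *m ad_mx c x = [x, v]. *)
Definition ad_mx (K : comNzRingType) (N : nat) (c : 'I_N -> 'I_N -> 'rV[K]_N)
  (x : 'rV[K]_N) : 'M[K]_N :=
  \matrix_(j < N, k < N) (lie_br c x (delta_mx 0 j)) 0 k.

Definition killing (K : comNzRingType) (N : nat) (c : 'I_N -> 'I_N -> 'rV[K]_N)
  (x y : 'rV[K]_N) : K := \tr (ad_mx c x *m ad_mx c y).

Definition cR (R : rcfType) (r : R) : R[i] := Complex r 0.
Definition cmx (R : rcfType) (p q : nat) (A : 'M[R]_(p, q)) : 'M[R[i]]_(p, q) :=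
  map_mx (@cR R) A.
Definition cpx (R : rcfType) (N : nat) (X Y : 'rV[R]_N) : 'rV[R[i]]_N :=
  \row_k Complex (X 0 k) (Y 0 k).

Definition lie_brC (R : rcfType) (N : nat) (c : 'I_N -> 'I_N -> 'rV[R]_N) :=
  lie_br (fun j k => cmx (c j k)).

Definition hvec (R : rcfType) (l m : nat) (H : 'rV[R]_l) : 'rV[R]_(l + m) :=
  row_mx H 0.
Definition xvec (R : rcfType) (l m : nat) (i : 'I_m) : 'rV[R]_(l + m) :=
  row_mx 0 (delta_mx 0 i).
Arguments xvec {R} l {m} i.
Definition hpart (R : rcfType) (l m : nat) (x : 'rV[R]_(l + m)) : 'rV[R]_l :=
  lsubmx x.
Definition xcoef (R : rcfType) (l m : nat) (x : 'rV[R]_(l + m)) (i : 'I_m) : R :=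
  rsubmx x 0 i.

(* V = h_R^*, also realised as 'rV[R]_l; pairing alpha(H). *)
Definition pairing (R : rcfType) (l : nat) (alpha H : 'rV[R]_l) : R :=
  \sum_(k < l) alpha 0 k * H 0 k.

Definition killH (R : rcfType) (l m : nat)
  (c : 'I_(l + m) -> 'I_(l + m) -> 'rV[R]_(l + m)) : 'M[R]_l :=
  \matrix_(k < l, k' < l)
    killing c (hvec m (delta_mx 0 k)) (hvec m (delta_mx 0 k')).

(* Inner product on V induced by the Killing form:
   <alpha, beta> = B(t_alpha, t_beta), where B(t_alpha, H) = alpha(H),
   i.e. t_alpha = alpha * (killH)^-1. *)
Definition ipV (R : rcfType) (l m : nat)
  (c : 'I_(l + m) -> 'I_(l + m) -> 'rV[R]_(l + m)) (alpha beta : 'rV[R]_l) : R :=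
  killing c (hvec m (alpha *m invmx (killH c))) (hvec m (beta *m invmx (killH c))).

Definition in_I_Phi (R : rcfType) (l m : nat)
  (c : 'I_(l + m) -> 'I_(l + m) -> 'rV[R]_(l + m)) (rt : 'I_m -> 'rV[R]_l)
  (s : 'M[R]_l) : Prop :=
  [/\ s *m s = 1%:M,
      (forall alpha beta, ipV c (alpha *m s) (beta *m s) = ipV c alpha beta) &
      (forall i, exists j, rt i *m s = rt j)].

Definition tau (R : rcfType) (l m : nat) (neg : 'I_m -> 'I_m)
  (x : 'rV[R]_(l + m)) : 'rV[R]_(l + m) :=
  - hvec m (hpart x) + \sum_(i < m) xcoef x i *: xvec l (neg i).

Definition g_u (R : rcfType) (l m : nat) (neg : 'I_m -> 'I_m)
  (v : 'rV[R[i]]_(l + m)) : Prop :=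
  exists X Y, [/\ tau neg X = X, tau neg Y = - Y & v = cpx X Y].

Definition anti_ext (R : rcfType) (N : nat) (sigma : 'M[R]_N)
  (v : 'rV[R[i]]_N) : 'rV[R[i]]_N :=
  cpx (map_mx (fun z : R[i] => complex.Re z) v *m sigma) (- (map_mx (fun z : R[i] => complex.Im z) v *m sigma)).

Definition maps_onto (A B : Type) (f : A -> B) (P : A -> Prop) (Q : B -> Prop) :=
  (forall x, P x -> Q (f x)) /\ (forall y, Q y -> exists x, P x /\ f x = y).

Definition hR_set (R : rcfType) (l m : nat) (x : 'rV[R]_(l + m)) : Prop :=
  exists H, x = hvec m H.

Definition in_Inv_tau (R : rcfType) (l m : nat)
  (c : 'I_(l + m) -> 'I_(l + m) -> 'rV[R]_(l + m)) (neg : 'I_m -> 'I_m)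
  (sigma : 'M[R]_(l + m)) : Prop :=
  [/\ sigma *m sigma = 1%:M,
      (forall x y, lie_br c x y *m sigma = lie_br c (x *m sigma) (y *m sigma)),
      maps_onto (fun x => x *m sigma) (@hR_set R l m) (@hR_set R l m) &
      maps_onto (anti_ext sigma) (g_u neg) (g_u neg)].

Definition rho_eq (R : rcfType) (l m : nat) (sigma : 'M[R]_(l + m)) (s : 'M[R]_l) :=
  forall (alpha H : 'rV[R]_l),
    pairing alpha (hpart (hvec m H *m invmx sigma)) = pairing (alpha *m s) H.

Definition Phi_s_bullet (R : rcfType) (l m : nat) (rt : 'I_m -> 'rV[R]_l)
  (s : 'M[R]_l) (i : 'I_m) : Prop := rt i *m s = - rt i.
Definition Phi_sigma_bullet (R : rcfType) (l m : nat) (rt : 'I_m -> 'rV[R]_l)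
  (neg : 'I_m -> 'I_m) (s : 'M[R]_l) (sigma : 'M[R]_(l + m)) (i : 'I_m) : Prop :=
  Phi_s_bullet rt s i /\ xvec l i *m sigma = xvec l (neg i).

Definition g_sigma (R : rcfType) (N : nat) (sigma : 'M[R]_N) (v : 'rV[R[i]]_N) : Prop :=
  exists X Y, [/\ X *m sigma = X, Y *m sigma = - Y & v = cpx X Y].

Definition h_set (R : rcfType) (l m : nat) (v : 'rV[R[i]]_(l + m)) : Prop :=
  exists H1 H2 : 'rV[R]_l, v = cpx (hvec m H1) (hvec m H2).

(* s^* : dual involution of h_R (alpha(s^* H) = (s alpha)(H)), i.e.
   H |-> H *m s^T;  h_s = h_s^+ (+) i h_s^-. *)
Definition h_s_set (R : rcfType) (l m : nat) (s : 'M[R]_l) (v : 'rV[R[i]]_(l + m)) :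
  Prop :=
  exists H1 H2 : 'rV[R]_l,
    [/\ H1 *m s^T = H1, H2 *m s^T = - H2 & v = cpx (hvec m H1) (hvec m H2)].

(* Standing assumptions: g = g_R (x) C complex semisimple with Cartan subalgebra
   h = h_R (x) C, root system Phi = {rt i}, Chevalley system (X_i = xvec i,
   H_i = hvec (cort i)), split real form g_R and tau an involutive
   automorphism of g_R. *)
Definition chevalley_setting (R : rcfType) (l m : nat)
  (c : 'I_(l + m) -> 'I_(l + m) -> 'rV[R]_(l + m))
  (rt : 'I_m -> 'rV[R]_l) (neg : 'I_m -> 'I_m) (cort : 'I_m -> 'rV[R]_l) : Prop :=
  (forall x, lie_br c x x = 0) /\
  (forall x y z, lie_br c x (lie_br c y z) + lie_br c y (lie_br c z x)
                 + lie_br c z (lie_br c x y) = 0) /\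
  (* semisimplicity of g (non-degenerate Killing form of g) *)
  (forall v : 'rV[R[i]]_(l + m),
      (forall w, killing (fun j k => cmx (c j k)) v w = 0) -> v = 0) /\
  (forall H H', lie_br c (hvec m H) (hvec m H') = 0) /\
  (forall H i, lie_br c (hvec m H) (xvec l i) = pairing (rt i) H *: xvec l i) /\
  injective rt /\ (forall i, rt i != 0) /\
  (forall i, rt (neg i) = - rt i) /\
  (forall i j, exists z : int, pairing (rt i) (cort j) = z%:~R) /\
  (forall i, lie_br c (xvec l i) (xvec l (neg i)) = - hvec m (cort i)) /\
  (forall i, lie_br c (hvec m (cort i)) (xvec l i) = 2%:R *: xvec l i) /\
  (forall i, lie_br c (hvec m (cort i)) (xvec l (neg i))
             = - (2%:R *: xvec l (neg i))) /\
  (forall x y, tau neg (lie_br c x y) = lie_br c (tau neg x) (tau neg y)).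

(* Main.v *)
Require Import Defs.
From HB Require Import structures.
From mathcomp Require Import all_boot all_order all_algebra.
From mathcomp Require Import reals complex.
From mathcomp Require Import ring lra.
Set Implicit Arguments. Unset Strict Implicit. Unset Printing Implicit Defensive.
Import Order.TTheory GRing.Theory Num.Theory.
Local Open Scope ring_scope.

(** Each [sigma_k] sends [X_a] to [eps_k(a) X_(s a)] with [eps_k(a) = 1] or [-1],
    and [chi = eps_1 eps_2] satisfies [chi(a + b) = chi(a) chi(b)] on roots, is
    [s]-invariant and, by hypothesis, is trivial on the roots with [s a = - a].
    We look for [phi] in the torus: identity on the Cartan subalgebra and
    [X_a |-> t(a) X_a] with [t] a unitary character of the root lattice such that
    [t(a) t(s a) = chi(a)].

    Such a [t] exists as soon as [prod chi(a_k) = 1] whenever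
    [sum (a_k + s a_k) = 0], which is proved by induction on the number of roots,
    without choosing a base: if [s a <> - a] then [(a + s a)(H_a) > 0], so some
    other [a_k] or [s a_k] pairs negatively with [H_a] and its sum with [a] is a
    root or zero.  The Smith normal form of the integers [(a_i + s a_i)(H_j)] then
    gives [t(a) = zeta ^ (a (sum_j z_j H_j))] with [zeta] a root of unity. *)

(** * Extending a sign character from the image lattice of an integer matrix *)

(** The character [n |-> (-1) ^ (n b)] is trivial on the left kernel of [A], hence factors through
    [n A]; the pair [(N, z)] extends it to all integer rows, as [x |-> zeta ^ (x z)] with
    [zeta ^ N = -1]. Smith normal form reduces the search for [z] to independent scalar
    equations. *)
Lemma int_parity_solvable p (A : 'M[int]_p) (b : 'cV[int]_p) :
  (forall n : 'rV_p, n *m A = 0 -> (2 %| (n *m b)%R ord0 ord0)%Z) ->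
  exists N : nat, exists z w : 'cV[int]_p,
    (0 < N)%N /\ A *m z = N%:Z *: (b + 2%:Z *: w).
Proof.
move=> evenb; have [L uL [Q uQ [d _ defA]]] := int_Smith_normal_form A.
set D := \matrix_(i, j) _ in defA.
pose e (i : 'I_p) := d`_i.
have DE (x : 'cV_p) i : (D *m x) i 0 = e i * x i 0.
  rewrite mxE (bigD1 i) //= big1 ?addr0 ?mxE ?eqxx // => j nji.
  by move: nji; rewrite -val_eqE eq_sym mxE => /negPf /= ->; rewrite mul0r.
pose b' := invmx L *m b.
have evenb' (i : 'I_p) : e i = 0 -> (2 %| b' i ord0)%Z.
  move=> di0; have := evenb (delta_mx 0 i *m invmx L).
  rewrite -[_ *m _ *m b]mulmxA -/b' -[_ *m b']rowE mxE; apply.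
  rewrite defA !mulmxA mulmxKV // -rowE; apply/rowP=> k.
  by rewrite !mxE big1 // => j _; rewrite !mxE -/(e i) di0 mul0rn mul0r.
(* Zero invariant factors count as 1, so that [N] is positive and still divisible by every nonzero
   one. *)
pose n (i : 'I_p) := if e i == 0 then 1%N else absz (e i).
pose N := (\prod_i n i)%N.
have N_gt0 : (0 < N)%N.
  by apply: prodn_gt0 => i; rewrite /n; case: eqP => // /eqP; rewrite absz_gt0.
have dvdN (i : 'I_p) : e i != 0 -> (e i %| N%:Z)%Z.
  move=> di; rewrite dvdzE /= /N (bigD1 i) //= {1}/n (negPf di).
  exact: dvdn_mulr.
(* Where [e i] is nonzero, [y] solves the equation exactly; where it is zero, the left side vanishes
   and [w'] cancels the even entry of [b']. *)
pose y : 'cV[int]_p := \col_i (b' i 0 * (N%:Z %/ e i)%Z).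
pose w' : 'cV[int]_p := \col_i (if e i == 0 then - (b' i ord0 %/ 2)%Z else 0).
have Dy : D *m y = N%:Z *: (b' + 2%:Z *: w').
  apply/colP=> i; rewrite DE [y _ _]mxE [RHS]mxE [(b' + _) _ _]mxE [(_ *: w') _ _]mxE.
  rewrite [w' _ _]mxE; case: eqP => [di0 | /eqP di].
    have := divzK (evenb' i di0); rewrite di0 mul0r => {1}<-; ring.
  by rewrite mulr0 addr0 mulrCA [_ * (_ %/ _)%Z]mulrC divzK ?dvdN // mulrC.
exists N, (invmx Q *m y), (L *m w'); split=> //.
rewrite defA !mulmxA mulmxK // -mulmxA Dy -scalemxAr mulmxDr -scalemxAr.
by rewrite /b' mulKVmx.
Qed.

(** * Bilinearity of the bracket and the adjoint matrix *)

Section Bracket.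
Variables (K : comNzRingType) (N : nat) (c : 'I_N -> 'I_N -> 'rV[K]_N).
Local Notation br := (lie_br c).

Lemma lie_br_linear_r x : linear (br x).
Proof.
move=> a y z; rewrite /lie_br scaler_sumr -big_split; apply: eq_bigr => j _ /=.
rewrite scaler_sumr -big_split; apply: eq_bigr => k _ /=.
by rewrite !mxE scalerA -scalerDl; congr (_ *: _); ring.
Qed.

Lemma lie_br_linear_l y : linear (br^~ y).
Proof.
move=> a x z; rewrite /lie_br scaler_sumr -big_split; apply: eq_bigr => j _ /=.
rewrite scaler_sumr -big_split; apply: eq_bigr => k _ /=.
by rewrite !mxE scalerA -scalerDl; congr (_ *: _); ring.
Qed.

Lemma lie_brDr x y z : br x (y + z) = br x y + br x z.
Proof. by rewrite -[y]scale1r lie_br_linear_r !scale1r. Qed.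

Lemma lie_brDl x y z : br (x + y) z = br x z + br y z.
Proof. by rewrite -[x]scale1r lie_br_linear_l !scale1r. Qed.

Lemma lie_br0r x : br x 0 = 0.
Proof. by apply: (addIr (br x 0)); rewrite add0r -lie_brDr addr0. Qed.

Lemma lie_br0l x : br 0 x = 0.
Proof. by apply: (addIr (br 0 x)); rewrite add0r -lie_brDl addr0. Qed.

Lemma lie_brZr a x y : br x (a *: y) = a *: br x y.
Proof. by rewrite -[a *: y]addr0 lie_br_linear_r lie_br0r addr0. Qed.

Lemma lie_brZl a x y : br (a *: x) y = a *: br x y.
Proof. by rewrite -[a *: x]addr0 lie_br_linear_l lie_br0l addr0. Qed.

Lemma lie_brNr x y : br x (- y) = - br x y.
Proof. by rewrite -scaleN1r lie_brZr scaleN1r. Qed.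

Lemma lie_brNl x y : br (- x) y = - br x y.
Proof. by rewrite -scaleN1r lie_brZl scaleN1r. Qed.

Lemma lie_br_delta j k : br (delta_mx 0 j) (delta_mx 0 k) = c j k.
Proof.
rewrite /lie_br (bigD1 j) //= [X in _ + X]big1 ?addr0 => [|i ij].
  rewrite (bigD1 k) //= big1 ?addr0 => [|i ik]; rewrite !mxE ?eqxx.
    by rewrite mul1r scale1r.
  by rewrite (negPf ik) mulr0 scale0r.
by rewrite big1 // => k' _; rewrite !mxE (negPf ij) mul0r scale0r.
Qed.

Lemma lie_brE x y : br x y = y *m ad_mx c x.
Proof.
rewrite [in LHS](row_sum_delta y) mulmx_sum_row.
rewrite (big_morph (br x) (lie_brDr x) (lie_br0r x)); apply: eq_bigr => j _.
by rewrite lie_brZr; congr (_ *: _); apply/rowP => k; rewrite !mxE.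
Qed.

Lemma ad_mxZ a x : ad_mx c (a *: x) = a *: ad_mx c x.
Proof. by apply/matrixP => i j; rewrite !mxE lie_brZl !mxE. Qed.

End Bracket.

(** * The pairing between [V] and the real Cartan subalgebra *)

Section Pairing.
Variables (R : rcfType) (l : nat).
Implicit Types (a b H : 'rV[R]_l).

Lemma pairingE a H : pairing a H = (a *m H^T) 0 0.
Proof. by rewrite mxE; apply: eq_bigr => k _; rewrite mxE. Qed.

Lemma pairingDl a b H : pairing (a + b) H = pairing a H + pairing b H.
Proof. by rewrite !pairingE mulmxDl mxE. Qed.

Lemma pairingDr a H H' : pairing a (H + H') = pairing a H + pairing a H'.
Proof. by rewrite !pairingE linearD mulmxDr mxE. Qed.

Lemma pairingNl a H : pairing (- a) H = - pairing a H.
Proof. by rewrite !pairingE mulNmx mxE. Qed.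

Lemma pairing0l H : pairing 0 H = 0.
Proof. by rewrite pairingE mul0mx mxE. Qed.

Lemma pairing_mull a H (s : 'M_l) : pairing (a *m s) H = pairing a (H *m s^T).
Proof. by rewrite !pairingE trmx_mul trmxK mulmxA. Qed.

Lemma pairing_delta a k : pairing a (delta_mx 0 k) = a 0 k.
Proof.
rewrite /pairing (bigD1 k) //= big1 ?addr0 => [|j jk]; rewrite mxE ?eqxx ?mulr1 //.
by rewrite (negPf jk) mulr0.
Qed.

Lemma pairing_injl a b : (forall H, pairing a H = pairing b H) -> a = b.
Proof. by move=> eqab; apply/rowP => k; rewrite -!pairing_delta eqab. Qed.

Lemma pairing_injr H H' : (forall a, pairing a H = pairing a H') -> H = H'.
Proof.
have symp (a H0 : 'rV_l) : pairing a H0 = pairing H0 a.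
  by apply: eq_bigr => k _; rewrite mulrC.
by move=> eqH; apply: pairing_injl => a; rewrite symp eqH symp.
Qed.

End Pairing.

(** * Weights, brackets of root vectors and the Killing form *)

Section Roots.
Variables (R : realType) (l m : nat).
Variables (c : 'I_(l + m) -> 'I_(l + m) -> 'rV[R]_(l + m)).
Variables (rt : 'I_m -> 'rV[R]_l) (neg : 'I_m -> 'I_m) (cort : 'I_m -> 'rV[R]_l).
Hypothesis chev : chevalley_setting c rt neg cort.
Local Notation br := (lie_br c).
Local Notation hv := (@hvec R l m).
Local Notation X := (@xvec R l m).

Let brxx x : br x x = 0. Proof. by case: chev. Qed.
Let brHX H i : br (hv H) (X i) = pairing (rt i) H *: X i.
Proof. by case: chev => _ [_] [_] [_] []. Qed.
Let brHH H H' : br (hv H) (hv H') = 0.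
Proof. by case: chev => _ [_] [_] []. Qed.
Let brXneg i : br (X i) (X (neg i)) = - hv (cort i).
Proof. by case: chev => _ [_] [_] [_] [_] [_] [_] [_] [_] []. Qed.

Lemma rt_inj : injective rt.
Proof. by case: chev => _ [_] [_] [_] [_] []. Qed.

Lemma rt_neq0 i : rt i != 0.
Proof. by case: chev => _ [_] [_] [_] [_] [_] []. Qed.

Lemma rt_neg i : rt (neg i) = - rt i.
Proof. by case: chev => _ [_] [_] [_] [_] [_] [_] []. Qed.

Lemma rt_cort_int i j : exists z : int, pairing (rt i) (cort j) = z%:~R.
Proof. by case: chev => _ [_] [_] [_] [_] [_] [_] [_] []. Qed.

Lemma negK : involutive neg.
Proof. by move=> i; apply: rt_inj; rewrite !rt_neg opprK. Qed.

Lemma neg_neq i : neg i != i.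
Proof.
apply/eqP => /(congr1 rt); rewrite rt_neg => /esym/eqP.
by rewrite -addr_eq0 -mulr2n -scaler_nat scaler_eq0 pnatr_eq0 (negPf (rt_neq0 i)).
Qed.

Lemma xvecE i : X i = delta_mx 0 (rshift l i).
Proof. by rewrite delta_mx_rshift. Qed.

Lemma xvec_neq0 i : X i != 0.
Proof.
apply/eqP => /rowP/(_ (rshift l i))/eqP.
by rewrite xvecE !mxE !eqxx oner_eq0.
Qed.

Lemma rt_cort i : pairing (rt i) (cort i) = 2%:R.
Proof.
have: br (hv (cort i)) (X i) = 2%:R *: X i.
  by case: chev => _ [_] [_] [_] [_] [_] [_] [_] [_] [_] [].
rewrite brHX => /eqP; rewrite -subr_eq0 -scalerBl scaler_eq0 (negPf (xvec_neq0 i)).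
by rewrite orbF subr_eq0 => /eqP.
Qed.

Lemma lie_br_anti x y : br x y = - br y x.
Proof.
have := brxx (x + y).
by rewrite lie_brDl !lie_brDr !brxx add0r addr0 => /eqP; rewrite addr_eq0 => /eqP.
Qed.

Lemma lie_br_derivation x y z : br x (br y z) = br (br x y) z + br y (br x z).
Proof.
case: chev => _ [/(_ x y z) jac _]; move: jac.
rewrite (lie_br_anti z (br x y)) (lie_br_anti z x) lie_brNr => /eqP.
by rewrite subr_eq0 subr_eq => /eqP ->.
Qed.

Definition weight (p : 'I_(l + m)) : 'rV[R]_l :=
  match split p with inl _ => 0 | inr i => rt i end.

Lemma weight_lshift k : weight (lshift m k) = 0.
Proof. by rewrite /weight (unsplitK (inl k)). Qed.

Lemma weight_rshift i : weight (rshift l i) = rt i.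
Proof. by rewrite /weight (unsplitK (inr i)). Qed.

Lemma lie_br_hvec_delta H p :
  br (hv H) (delta_mx 0 p) = pairing (weight p) H *: delta_mx 0 p.
Proof.
rewrite -[p]splitK; case: (split p) => [k | i] /=.
  by rewrite weight_lshift pairing0l scale0r delta_mx_lshift; apply: brHH.
by rewrite weight_rshift -xvecE brHX.
Qed.

Lemma lie_br_hvec_coord H x p : br (hv H) x 0 p = pairing (weight p) H * x 0 p.
Proof.
rewrite {1}(row_sum_delta x) (big_morph (br (hv H)) (lie_brDr c _) (lie_br0r c _)).
rewrite summxE (bigD1 p) //= big1 ?addr0 => [|q qp].
  by rewrite lie_brZr lie_br_hvec_delta !mxE !eqxx mulr1 mulrC.
by rewrite lie_brZr lie_br_hvec_delta !mxE eq_sym (negPf qp) !mulr0.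
Qed.

Definition weight_vector (a : 'rV[R]_l) (x : 'rV[R]_(l + m)) :=
  forall H, br (hv H) x = pairing a H *: x.

Lemma weight_vector_delta p : weight_vector (weight p) (delta_mx 0 p).
Proof. by move=> H; apply: lie_br_hvec_delta. Qed.

Lemma weight_vector_xvec i : weight_vector (rt i) (X i).
Proof. by move=> H; apply: brHX. Qed.

Lemma weight_vector_lie_br a b x y :
  weight_vector a x -> weight_vector b y -> weight_vector (a + b) (br x y).
Proof.
move=> wx wy H; rewrite lie_br_derivation wx wy lie_brZl lie_brZr.
by rewrite -scalerDl pairingDl.
Qed.

Lemma weight_vector_coord a x p : weight_vector a x -> x 0 p != 0 -> weight p = a.
Proof.
move=> wx xp; apply: pairing_injl => H; apply: (mulIf xp).
by rewrite -lie_br_hvec_coord wx mxE.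
Qed.

Lemma row_neq0_coord n (x : 'rV[R]_n) : x != 0 -> exists p, x 0 p != 0.
Proof.
move=> x0; apply/existsP; apply: contraNT x0 => /existsPn x0.
by apply/eqP/rowP => p; rewrite mxE; apply/eqP; have := x0 p; rewrite negbK.
Qed.

(** Root spaces are lines: the basis vectors have weight [0] or [rt j], and the [rt j] are nonzero
    and pairwise distinct. *)
Lemma weight_vector_root i x :
  weight_vector (rt i) x -> x = x 0 (rshift l i) *: X i.
Proof.
move=> wx; apply/rowP => p; rewrite xvecE !mxE eqxx /=.
case: (p =P _) => [-> | /eqP pi]; first by rewrite mulr1.
rewrite mulr0; apply/eqP; apply: contraNT pi => /(weight_vector_coord wx).
rewrite -[p]splitK; case: (split p) => [k | j] /=.
  by rewrite weight_lshift => /esym/eqP; rewrite (negPf (rt_neq0 i)).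
by rewrite weight_rshift => /rt_inj->.
Qed.

(* If [X_i, X_j] = 0, then X_j generates a lowering string under ad X_{-i} that
   never vanishes, with ad H_i-eigenvalues decreasing without bound. *)
Lemma lie_br_xvec_neq0 i j :
  pairing (rt j) (cort i) < 0 -> br (X i) (X j) != 0.
Proof.
set q := pairing _ _ => q_lt0; apply/eqP => brij.
pose h := hv (cort i); pose v k := iter k (br (X (neg i))) (X j).
have hvk k : br h (v k) = (q - 2%:R * k%:R) *: v k.
  elim: k => [|k IHk]; first by rewrite mulr0 subr0 /h brHX.
  rewrite /= lie_br_derivation -/(v k) IHk /h brHX lie_brZl lie_brZr -scalerDl.
  by rewrite rt_neg pairingNl rt_cort -natr1; congr (_ *: _); ring.
(* The coefficient is a sum of terms [- (q - 2 j)] for [j <= k], all positive since [q < 0]; hence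
   no vector of the string can vanish. *)
have evk k : exists2 a, 0 < a & br (X i) (v k.+1) = a *: v k.
  elim: k => [|k [a a_gt0 IHk]].
    exists (- q); first by rewrite oppr_gt0.
    by rewrite /= lie_br_derivation brij lie_br0r addr0 brXneg lie_brNl brHX scaleNr.
  exists (- (q - 2%:R * k.+1%:R) + a).
    by rewrite addr_gt0 // oppr_gt0 subr_lt0 (lt_le_trans q_lt0) // -natrM ler0n.
  have -> : v k.+2 = br (X (neg i)) (v k.+1) by [].
  rewrite lie_br_derivation IHk brXneg lie_brNl -/h hvk lie_brZr.
  by rewrite [RHS]scalerDl scaleNr.
have vk0 k : v k != 0.
  elim: k => [|k IHk]; first exact: xvec_neq0.
  have [a a_gt0 eva] := evk k; apply: contraNneq IHk => vk0.
  move/eqP: eva; rewrite vk0 lie_br0r eq_sym scaler_eq0.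
  by rewrite (gt_eqF a_gt0).
pose M := \sum_p `|pairing (weight p) (cort i)|.
have M_ge0 : 0 <= M by apply: sumr_ge0 => p _; apply: normr_ge0.
have leM k : - M <= q - 2%:R * k%:R.
  have [p vkp] := row_neq0_coord (vk0 k).
  have <- : pairing (weight p) (cort i) = q - 2%:R * k%:R.
    by apply: (mulIf vkp); rewrite -lie_br_hvec_coord -/h hvk mxE.
  apply: lerNnormlW; rewrite /M (bigD1 p) //= lerDl.
  by apply: sumr_ge0 => ? _; apply: normr_ge0.
have := leM (Num.bound M); have := archi_boundP M_ge0; lra.
Qed.

(** The bracket has weight [rt i + rt j], which must be the weight of any basis vector occurring in
    it: [0] for a Cartan coordinate, a root otherwise. *)
Lemma lie_br_xvec_root i j : br (X i) (X j) != 0 ->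
  rt i + rt j = 0 \/
  exists2 k, rt k = rt i + rt j &
    exists2 n, n != 0 & br (X i) (X j) = n *: X k.
Proof.
move=> nz; have [p nzp] := row_neq0_coord nz.
have wij := weight_vector_lie_br (weight_vector_xvec i) (weight_vector_xvec j).
have := weight_vector_coord wij nzp; move: nzp.
rewrite -[p]splitK; case: (split p) => [k | k] /=.
  by rewrite weight_lshift; left.
rewrite weight_rshift => nzk rtk; right; exists k => //.
by exists (br (X i) (X j) 0 (rshift l k)); rewrite // -weight_vector_root // rtk.
Qed.

(** This is the Jacobi identity; the products appear in reverse order because matrices act on row
    vectors from the right. *)
Lemma ad_mx_lie_br x y :
  ad_mx c (br x y) = ad_mx c y *m ad_mx c x - ad_mx c x *m ad_mx c y.
Proof.
apply/row_matrixP => p; rewrite !rowE mulmxBr !mulmxA -!lie_brE.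
by rewrite (lie_br_derivation x) addrK.
Qed.

Lemma killing_invariant x y z : killing c (br x y) z = killing c x (br y z).
Proof.
rewrite /killing !ad_mx_lie_br mulmxBl mulmxBr !linearB /=.
by rewrite -!mulmxA; congr (_ - _); rewrite mxtrace_mulC mulmxA.
Qed.

(** Elements of the Cartan subalgebra act diagonally with the weights as entries. The resulting sum
    of squares supplies all the positivity used later. *)
Lemma killing_hvec H H' :
  killing c (hv H) (hv H') = \sum_i pairing (rt i) H * pairing (rt i) H'.
Proof.
have ad_diag H0 : ad_mx c (hv H0) = diag_mx (\row_p pairing (weight p) H0).
  apply/matrixP => p k; rewrite !mxE lie_br_hvec_delta !mxE eqxx /= eq_sym.
  by rewrite mulr_natr.
rewrite /killing !ad_diag mulmx_diag mxtrace_diag big_split_ord /= big1 ?add0r.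
  by apply: eq_bigr => i _; rewrite !mxE weight_rshift.
by move=> k _; rewrite !mxE weight_lshift !pairing0l mul0r.
Qed.

(** Invariance of the Killing form applied to [H_i = - [X_i, X_{-i}]] gives the proportionality. Its
    sign comes from evaluating at [H_i]: the sum of squares contains the term [2 ^ 2]. *)
Lemma killing_cort i : exists2 a, 0 < a &
  forall H, killing c (hv (cort i)) (hv H) = a * pairing (rt i) H.
Proof.
pose a := - killing c (X i) (X (neg i)).
have killE H : killing c (hv (cort i)) (hv H) = a * pairing (rt i) H.
  have <- : br (- X i) (X (neg i)) = hv (cort i) by rewrite lie_brNl brXneg opprK.
  rewrite killing_invariant lie_br_anti brHX rt_neg pairingNl scaleNr opprK.
  rewrite /killing -scaleN1r !ad_mxZ -scalemxAr -scalemxAl !linearZ /= /a /killing.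
  ring.
exists a => //; have := killE (cort i); rewrite rt_cort killing_hvec => sumE.
suff : 0 < a * 2%:R by rewrite pmulr_lgt0.
rewrite -sumE (bigD1 i) //= ltr_pwDl ?sumr_ge0 // => [|j _]; rewrite -?expr2 ?sqr_ge0 //.
by rewrite rt_cort -natrX ltr0n.
Qed.

End Roots.

(** * The permutation [S] of the roots induced by [s] *)

Section RootInvolution.
Variables (R : realType) (l m : nat).
Variables (c : 'I_(l + m) -> 'I_(l + m) -> 'rV[R]_(l + m)).
Variables (rt : 'I_m -> 'rV[R]_l) (neg : 'I_m -> 'I_m) (cort : 'I_m -> 'rV[R]_l).
Hypothesis chev : chevalley_setting c rt neg cort.
Local Notation br := (lie_br c).
Local Notation hv := (@hvec R l m).
Local Notation X := (@xvec R l m).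

Variables (s : 'M[R]_l) (S : 'I_m -> 'I_m).
Hypothesis s_inv : s *m s = 1%:M.
Hypothesis rtS : forall i, rt (S i) = rt i *m s.

Lemma root_permK : involutive S.
Proof. by move=> i; apply: (rt_inj chev); rewrite !rtS -mulmxA s_inv mulmx1. Qed.

Lemma root_perm_neg i : S (neg i) = neg (S i).
Proof. by apply: (rt_inj chev); rewrite rtS !(rt_neg chev) mulNmx rtS. Qed.

Lemma trmx_invK : s^T *m s^T = 1%:M.
Proof. by rewrite -trmx_mul s_inv trmx1. Qed.

(** * Triviality of the sign character on families with vanishing orbit sum *)

Section AlongCoroots.
Hypothesis cortS : forall i, cort (S i) = cort i *m s^T.

(* alpha and s alpha have the same length, so <s alpha, alpha^v> > -2 unless
   s alpha = - alpha. *)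
Lemma pairing_orbit_gt0 i :
  rt i + rt (S i) != 0 -> 0 < pairing (rt i + rt (S i)) (cort i).
Proof.
move=> nz; have [a a_gt0 kill_i] := killing_cort chev i.
have [a' a'_gt0 kill_Si] := killing_cort chev (S i).
have eq_a : a' = a.
  have /mulIf : 2%:R != 0 :> R by rewrite pnatr_eq0.
  apply; rewrite -{1}(rt_cort chev (S i)) -{1}(rt_cort chev i) -kill_i -kill_Si.
  rewrite !(killing_hvec chev) (reindex_inj (inv_inj root_permK)) /=.
  apply: eq_bigr => j _.
  by rewrite cortS -pairing_mull -rtS root_permK.
have pSi : pairing (rt i) (cort (S i)) = pairing (rt (S i)) (cort i).
  by rewrite cortS -pairing_mull -rtS.
(* [a] times [rt i + rt (S i)] is the Killing dual of [H], and [B(H, H)] is [2 a] times the pairing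
   in question. If that is at most 0, the sum of squares [B(H, H)] vanishes, so all roots vanish on
   [H] and [rt i + rt (S i) = 0]. *)
pose H := cort i + cort (S i).
have killH H' : killing c (hv H) (hv H') = a * pairing (rt i + rt (S i)) H'.
  rewrite (killing_hvec chev) pairingDl mulrDr -{2}eq_a -kill_i -kill_Si.
  rewrite !(killing_hvec chev) -big_split; apply: eq_bigr => j _ /=.
  by rewrite pairingDr mulrDl.
rewrite ltNge; apply: contra nz => le0; apply/eqP/pairing_injl => H'.
rewrite pairing0l; apply: (mulfI (lt0r_neq0 a_gt0)); rewrite mulr0 -killH.
have sq0 j : pairing (rt j) H = 0.
  have ge0 k : true -> 0 <= pairing (rt k) H * pairing (rt k) H.
    by rewrite -expr2 sqr_ge0.
  have /eqP sum0 : \sum_k pairing (rt k) H * pairing (rt k) H == 0.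
    rewrite eq_le sumr_ge0 // andbT -(killing_hvec chev) killH pmulr_rle0 //.
    rewrite pairingDr; move: le0; rewrite !pairingDl pSi !(rt_cort chev); lra.
  have := psumr_eq0P ge0 sum0; move/(_ j isT)/eqP; rewrite mulf_eq0 orbb.
  by move/eqP.
by rewrite (killing_hvec chev) big1 // => j _; rewrite sq0 mul0r.
Qed.

Variable chi : 'I_m -> R.
Hypothesis chi_sq : forall i, chi i * chi i = 1.
Hypothesis chiS : forall i, chi (S i) = chi i.
Hypothesis chi_neg : forall i, chi (neg i) = chi i.
Hypothesis chi_imag : forall i, rt (S i) = - rt i -> chi i = 1.
Hypothesis chi_add : forall i j k,
  br (X i) (X j) != 0 -> rt k = rt i + rt j -> chi k = chi i * chi j.

(* Any root a of the family with s a <> - a pairs negatively with some other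
   member i or with its image S i; replacing {a, i} by their sum, which is a root
   or zero, shortens the family without changing either side. *)
Lemma prod_sign_character_eq1 (w : seq 'I_m) :
  (forall j, \sum_(i <- w) pairing (rt i + rt (S i)) (cort j) = 0) ->
  \prod_(i <- w) chi i = 1.
Proof.
have [n] := ubnP (size w); elim: n w => // n IHn [|a w] /=; first by rewrite big_nil.
rewrite ltnS => szw sum0; pose g i := rt i + rt (S i).
have gS i : g (S i) = g i by rewrite /g root_permK addrC.
have [ga0 | ga_neq0] := eqVneq (g a) 0.
  rewrite big_cons chi_imag ?mul1r; last first.
    by apply/eqP; rewrite -addr_eq0 addrC; apply/eqP.
  by apply: IHn => // j; have := sum0 j; rewrite big_cons -/(g a) ga0 pairing0l add0r.
have /hasP[i iw gi_lt0] : has (fun i => pairing (g i) (cort a) < 0) w.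
  apply: contraPT (sum0 a) => /hasPn ge0; apply/eqP; rewrite gt_eqF // big_cons.
  rewrite ltr_pwDl ?pairing_orbit_gt0 // big_seq sumr_ge0 // => i iw.
  by rewrite leNgt; apply: ge0.
have [i' [gi' chii' i'_lt0]] :
    exists i', [/\ g i' = g i, chi i' = chi i & pairing (rt i') (cort a) < 0].
  have [lt0 | ge0] := ltP (pairing (rt i) (cort a)) 0; first by exists i.
  exists (S i); split=> //; rewrite -(ltrD2l (pairing (rt i) (cort a))) -pairingDl.
  by rewrite addr0 (lt_le_trans gi_lt0).
have pw := perm_to_rem iw; set w' := rem i w in pw.
have szw' : size w = (size w').+1 by rewrite (perm_size pw).
have sum0' j : pairing (g a + g i') (cort j) + \sum_(k <- w') pairing (g k) (cort j) = 0.
  by have := sum0 j; rewrite gi' pairingDl big_cons (perm_big _ pw) big_cons addrA.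
rewrite big_cons (perm_big _ pw) big_cons /= mulrA -chii'.
have gD : g a + g i' = (rt a + rt i') + (rt a + rt i') *m s.
  by rewrite /g !rtS mulmxDl addrACA.
have br_neq0 := lie_br_xvec_neq0 chev i'_lt0.
case: (lie_br_xvec_root chev br_neq0) => [rt0 | [k rtk _]].
  have -> : i' = neg a.
    by apply: (rt_inj chev); rewrite (rt_neg chev); apply/eqP; rewrite -addr_eq0 addrC rt0.
  rewrite chi_neg chi_sq mul1r; apply: IHn => [|j].
    by rewrite (ltn_trans _ szw) // szw'.
  by have := sum0' j; rewrite gD rt0 mul0mx addr0 pairing0l add0r.
rewrite -(chi_add br_neq0 rtk).
have := IHn (k :: w'); rewrite big_cons; apply=> [|j].
  by rewrite /= -szw'.
by rewrite big_cons rtS rtk -gD sum0'.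
Qed.

End AlongCoroots.

(** * Action of an involution over [s] on the Chevalley vectors *)

Section SignedPermutation.
Variable sigma : 'M[R]_(l + m).
Hypothesis sigma_inv_tau : in_Inv_tau c neg sigma.
Hypothesis sigma_rho : rho_eq sigma s.

Lemma sigma_hvec H : hv H *m sigma = hv (H *m s^T).
Proof.
have [ss1 _ [hR _] _] := sigma_inv_tau.
have inv_sigma : invmx sigma = sigma.
  by have [us _] := mulmx1_unit ss1; rewrite -[LHS]mulmx1 -ss1 mulKmx.
have [|H' eqH'] := hR (hv H); first by exists H.
rewrite eqH'; congr (hvec m _); apply: pairing_injr => a.
have := sigma_rho a H; rewrite inv_sigma eqH' pairing_mull => <-.
by rewrite /hpart row_mxKl.
Qed.

(** A [tau]-fixed real vector lies in the compact form, which the antilinear extension preserves,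
    and the real part of an element of the compact form is [tau]-fixed. *)
Lemma tau_fixed_image x : tau neg x = x -> tau neg (x *m sigma) = x *m sigma.
Proof.
move=> taux; have tau0 : tau neg (0 : 'rV[R]_(l + m)) = - 0.
  rewrite /tau /hpart /hvec linear0 row_mx0 oppr0 add0r big1 // => i _.
  by rewrite /xcoef linear0 mxE scale0r.
have [_ _ _ [gu _]] := sigma_inv_tau.
have [|X' [Y' [tauX' _ eqX']]] := gu (cpx x 0); first by exists x, 0.
suff -> : x *m sigma = X' by [].
apply/rowP => k; have /rowP/(_ k) := eqX'; rewrite /anti_ext !mxE => -[<- _].
by apply: eq_bigr => j _; rewrite !mxE.
Qed.

Lemma tau_xvec2 (a b : R) i j :
  tau neg (a *: X i + b *: X j) = a *: X (neg i) + b *: X (neg j).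
Proof.
have XE : a *: X i + b *: X j = row_mx 0 (a *: delta_mx 0 i + b *: delta_mx 0 j).
  by rewrite /xvec !scale_row_mx add_row_mx !scaler0 addr0.
rewrite /tau /hpart /xcoef XE row_mxKl row_mxKr /hvec row_mx0 oppr0 add0r.
under eq_bigr => k _ do rewrite !mxE scalerDl -!scalerA.
rewrite big_split /= -!scaler_sumr; congr (_ *: _ + _ *: _).
  rewrite (bigD1 i) //= big1 ?addr0 ?eqxx ?scale1r // => k ki.
  by rewrite (negPf ki) scale0r.
rewrite (bigD1 j) //= big1 ?addr0 ?eqxx ?scale1r // => k kj.
by rewrite (negPf kj) scale0r.
Qed.

(** Root spaces are lines, so [sigma] acts by scalars [eps]. Preservation of the [tau]-fixed vector
    [X_i + X_{-i}] equates [eps] at opposite roots; the image of [[X_i, X_{-i}]] then gives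
    [cort i *m s^T = eps i ^+ 2 *: cort (S i)], and pairing with [rt (S i)] yields 2 on the left and
    [2 eps^2] on the right. Finally [sigma^2 = 1] gives invariance under [S]. *)
Lemma sigma_xvec : exists eps : 'I_m -> R,
  [/\ forall i, X i *m sigma = eps i *: X (S i),
      forall i, eps i ^+ 2 = 1,
      forall i, eps (neg i) = eps i,
      forall i, eps (S i) = eps i &
      forall i, cort (S i) = cort i *m s^T].
Proof.
have [ss1 sigma_br _ _] := sigma_inv_tau.
pose eps i := (X i *m sigma) 0 (rshift l (S i)).
have epsE i : X i *m sigma = eps i *: X (S i).
  apply: (weight_vector_root chev) => H.
  have -> : hv H = hv (H *m s^T) *m sigma.
    by rewrite sigma_hvec -mulmxA trmx_invK mulmx1.
  by rewrite -sigma_br (weight_vector_xvec chev) -scalemxAl -pairing_mull -rtS.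
have Xcoord i j : X i 0 (rshift l j) = (i == j)%:R.
  by rewrite xvecE mxE eqxx (inj_eq (@rshift_inj _ _)) eq_sym.
have Xcoord2 a b i j k :
    (a *: X i + b *: X j) 0 (rshift l k) = a * (i == k)%:R + b * (j == k)%:R.
  by rewrite -!Xcoord !xvecE !mxE.
have eps_neg i : eps (neg i) = eps i.
  have /tau_fixed_image : tau neg (1 *: X i + 1 *: X (neg i)) = 1 *: X i + 1 *: X (neg i).
    by rewrite tau_xvec2 (negK chev) addrC.
  rewrite !scale1r mulmxDl !epsE tau_xvec2 root_perm_neg (negK chev).
  move/rowP/(_ (rshift l (S i))); rewrite !Xcoord2 eqxx.
  by rewrite (negPf (neg_neq chev _)) !mulr0 !mulr1 addr0 add0r.
have XnegE i : br (X i) (X (neg i)) = - hv (cort i).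
  by case: chev => _ [_] [_] [_] [_] [_] [_] [_] [_] [].
have cortE i : cort i *m s^T = eps i ^+ 2 *: cort (S i).
  have := sigma_br (X i) (X (neg i)).
  rewrite XnegE mulNmx sigma_hvec !epsE lie_brZl lie_brZr eps_neg root_perm_neg.
  rewrite XnegE !scalerN => /oppr_inj; rewrite scalerA -expr2 /hvec scale_row_mx.
  by case/eq_row_mx.
have eps_sq i : eps i ^+ 2 = 1.
  have /mulIf : 2%:R != 0 :> R by rewrite pnatr_eq0.
  apply; rewrite mul1r -[in LHS](rt_cort chev (S i)) -[RHS](rt_cort chev i).
  have -> : eps i ^+ 2 * pairing (rt (S i)) (cort (S i)) =
            pairing (rt (S i)) (eps i ^+ 2 *: cort (S i)).
    by rewrite !pairingE linearZ /= -scalemxAr [RHS]mxE.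
  by rewrite -cortE rtS pairing_mull -mulmxA trmx_invK mulmx1.
exists eps; split=> // i; last by rewrite cortE eps_sq scale1r.
have := congr1 (fun A => X i *m A) ss1; rewrite mulmxA epsE -scalemxAl epsE mulmx1.
rewrite root_permK scalerA => /rowP/(_ (rshift l i)); rewrite [LHS]mxE !Xcoord eqxx mulr1.
by move=> eps1; rewrite -[LHS]mul1r -(eps_sq i) expr2 -mulrA eps1 mulr1.
Qed.

Lemma sigma_coord_hvec k q : sigma (lshift m k) q = hv (delta_mx 0 k *m s^T) 0 q.
Proof. by rewrite -sigma_hvec /hvec -delta_mx_lshift -rowE mxE. Qed.

End SignedPermutation.

Lemma sigma_coord_xvec (sigma : 'M[R]_(l + m)) (eps : 'I_m -> R) i q :
  X i *m sigma = eps i *: X (S i) ->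
  sigma (rshift l i) q = eps i * (q == rshift l (S i))%:R.
Proof. by rewrite !xvecE -rowE => /rowP/(_ q); rewrite !mxE eqxx. Qed.

(** Each [sigma] only gives [n eps(k) = eps(i) eps(j) n'], where [n] and [n'] are the structure
    constants for the pairs [i, j] and [S i, S j]. These constants are the same for both
    involutions, so they drop out of the product. *)
Lemma sign_character_add (sigma1 sigma2 : 'M[R]_(l + m)) (eps1 eps2 : 'I_m -> R) :
  in_Inv_tau c neg sigma1 -> in_Inv_tau c neg sigma2 ->
  (forall i, X i *m sigma1 = eps1 i *: X (S i)) ->
  (forall i, X i *m sigma2 = eps2 i *: X (S i)) ->
  (forall i, eps1 i ^+ 2 = 1) -> (forall i, eps2 i ^+ 2 = 1) ->
  forall i j k, br (X i) (X j) != 0 -> rt k = rt i + rt j ->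
  eps1 k * eps2 k = (eps1 i * eps2 i) * (eps1 j * eps2 j).
Proof.
move=> [_ br1 _ _] [_ br2 _ _] E1 E2 sq1 sq2 i j k nz rtk.
have [n n_neq0 brE] : exists2 n, n != 0 & br (X i) (X j) = n *: X k.
  case: (lie_br_xvec_root chev nz) => [rt0 | [k' rtk' [n n0 brE]]].
    by have := rt_neq0 chev k; rewrite rtk rt0 eqxx.
  by exists n => //; rewrite brE (rt_inj chev (etrans rtk' (esym rtk))).
pose n' := br (X (S i)) (X (S j)) 0 (rshift l (S k)).
have coordE (sg : 'M[R]_(l + m)) (eps : 'I_m -> R) :
    (forall x y, br x y *m sg = br (x *m sg) (y *m sg)) ->
    (forall h, X h *m sg = eps h *: X (S h)) ->
    n * eps k = eps i * eps j * n'.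
  move=> brs E; have := brs (X i) (X j); rewrite brE !E -scalemxAl E lie_brZl lie_brZr.
  rewrite !scalerA => /rowP/(_ (rshift l (S k))); rewrite [LHS]mxE [RHS]mxE.
  by rewrite {1}xvecE mxE !eqxx mulr1.
have e1 := coordE _ _ br1 E1; have e2 := coordE _ _ br2 E2.
have n'_neq0 : n' != 0.
  apply: contraNneq n_neq0 => n'0; move: e1; rewrite n'0 mulr0 => /eqP.
  rewrite mulf_eq0 => /orP[//|/eqP ek]; have := sq1 k; rewrite ek expr0n /= => /eqP.
  by rewrite eq_sym oner_eq0.
apply: (mulfI (mulf_neq0 n_neq0 n'_neq0)).
have -> : n * n' * (eps1 k * eps2 k) = (n * eps1 k) * n' * eps2 k by ring.
have n2 : n * eps2 k * eps2 k = n by rewrite -mulrA -expr2 sq2 mulr1.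
have n'2 : n' = n * eps2 k * (eps2 i * eps2 j).
  rewrite e2; transitivity (n' * (eps2 i ^+ 2) * (eps2 j ^+ 2)); last ring.
  by rewrite !sq2 !mulr1.
rewrite e1 {2}n'2.
transitivity (eps1 i * eps1 j * n' * (eps2 i * eps2 j) * (n * eps2 k * eps2 k)); first ring.
rewrite n2; ring.
Qed.

End RootInvolution.

(** * Real forms as fixed points of antilinear maps, and diagonal automorphisms *)

(** The antilinear extension sends [x + i y] to [x sigma - i (y sigma)]; comparing real and
    imaginary parts identifies its fixed vectors. *)
Lemma g_sigmaP (R : rcfType) N (sigma : 'M[R]_N) (v : 'rV[R[i]]_N) :
  g_sigma sigma v <-> map_mx conjc v *m cmx sigma = v.
Proof.
have conjE (x y : 'rV[R]_N) :
    map_mx conjc (cpx x y) *m cmx sigma = cpx (x *m sigma) (- (y *m sigma)).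
  apply/rowP => k; rewrite !mxE -sumrN.
  elim/big_rec3: _ => // j y1 y2 y3 _ ->; rewrite !mxE /cR.
  by apply/eqP; rewrite eq_complex /= !mulr0 subr0 add0r mulNr !eqxx.
split=> [[x [y [Ex Ey ->]]] | Ev]; first by rewrite conjE Ex Ey opprK.
pose x := map_mx (fun z : R[i] => complex.Re z) v.
pose y := map_mx (fun z : R[i] => complex.Im z) v.
have vE : v = cpx x y by apply/rowP => k; rewrite !mxE; case: (v 0 k).
move: Ev; rewrite vE conjE => /rowP Ev; exists x, y; split=> //.
  by apply/rowP => k; have := Ev k; rewrite !mxE => -[].
by apply/rowP => k; have := Ev k; rewrite !mxE => -[_ <-]; rewrite opprK.
Qed.

(** The matrix identity says that [phi] intertwines the two antilinear extensions, hence carries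
    fixed vectors to fixed vectors; its inverse does the same in the other direction. *)
Lemma maps_onto_g_sigma (R : rcfType) N (sigma1 sigma2 : 'M[R]_N) (phi : 'M[R[i]]_N) :
  phi \in unitmx -> map_mx conjc phi *m cmx sigma1 = cmx sigma2 *m phi ->
  maps_onto (fun v => v *m phi) (g_sigma sigma2) (g_sigma sigma1).
Proof.
move=> uphi comm; split=> [v /g_sigmaP Ev | y /g_sigmaP Ey].
  by apply/g_sigmaP; rewrite map_mxM -mulmxA comm mulmxA Ev.
exists (y *m invmx phi); rewrite mulmxKV //; split=> //; apply/g_sigmaP.
rewrite -[RHS](mulmxK uphi) -[LHS](mulmxK uphi); congr (_ *m invmx phi).
by rewrite -mulmxA -comm mulmxA -map_mxM mulmxKV.
Qed.

(** Modulus one follows from [|zeta| ^ N = 1]; it turns conjugation of the torus values into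
    inversion. *)
Lemma exists_unitary_root_opp1 (R : rcfType) (N : nat) : (0 < N)%N ->
  exists zeta : R[i], [/\ zeta != 0, zeta ^+ N = -1 & conjc zeta = zeta^-1].
Proof.
move=> N_gt0; pose zeta : R[i] := N.-root (-1).
have zetaN : zeta ^+ N = -1 by rewrite rootCK.
have zeta0 : zeta != 0.
  apply/eqP => z0; move/eqP: zetaN; rewrite z0 expr0n eqn0Ngt N_gt0 /=.
  by rewrite eq_sym oppr_eq0 oner_eq0.
exists zeta; split=> //.
have norm1 : `|zeta| = 1.
  apply/eqP; rewrite -(@pexpr_eq1 _ _ N) // -normrX zetaN normrN normr1 //.
by apply: (mulfI zeta0); rewrite divff // -sqr_normc norm1 expr1n.
Qed.

Lemma lie_br_diag (K : comNzRingType) N (c : 'I_N -> 'I_N -> 'rV[K]_N) (d : 'rV[K]_N) :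
  (forall j k p, c j k 0 p * d 0 p = d 0 j * d 0 k * c j k 0 p) ->
  forall v w, lie_br c v w *m diag_mx d =
              lie_br c (v *m diag_mx d) (w *m diag_mx d).
Proof.
move=> cd v w; rewrite /lie_br mulmx_suml; apply: eq_bigr => j _.
rewrite mulmx_suml; apply: eq_bigr => k _; apply/rowP => p.
rewrite -scalemxAl !mul_mx_diag !mxE cd; ring.
Qed.

(** * Torus automorphisms given by integral combinations of coroots *)

Section Torus.
Variables (R : realType) (l m : nat).
Variables (c : 'I_(l + m) -> 'I_(l + m) -> 'rV[R]_(l + m)).
Variables (rt : 'I_m -> 'rV[R]_l) (neg : 'I_m -> 'I_m) (cort : 'I_m -> 'rV[R]_l).
Hypothesis chev : chevalley_setting c rt neg cort.

(** The pairing is already an integer; [Num.floor] only extracts it. *)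
Definition cartan_int (p : 'I_(l + m)) (j : 'I_m) : int :=
  Num.floor (pairing (weight rt p) (cort j)).

Lemma cartan_intE p j : (cartan_int p j)%:~R = pairing (weight rt p) (cort j).
Proof.
suff [z Ez] : exists z : int, pairing (weight rt p) (cort j) = z%:~R.
  by rewrite /cartan_int Ez intrKfloor.
rewrite -[p]splitK; case: (split p) => [k | i] /=.
  by exists 0; rewrite weight_lshift pairing0l.
by rewrite weight_rshift; apply: (rt_cort_int chev).
Qed.

(** The weight of [p] evaluated at the coroot combination [sum_j z_j H_j]. *)
Definition torus_exp (z : 'cV[int]_m) p : int := \sum_j cartan_int p j * z j 0.

Definition torus_row (zeta : R[i]) (z : 'cV[int]_m) : 'rV[R[i]]_(l + m) :=
  \row_p zeta ^ torus_exp z p.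

Lemma torus_exp_lshift z k : torus_exp z (lshift m k) = 0.
Proof.
rewrite /torus_exp big1 // => j _.
suff -> : cartan_int (lshift m k) j = 0 by rewrite mul0r.
by rewrite /cartan_int weight_lshift pairing0l floor0.
Qed.

(** The exponent is additive in the weight, and a nonzero structure constant [c j k 0 p] forces the
    weight of [p] to be the sum of those of [j] and [k]. *)
Lemma torus_row_lie_br zeta z : zeta != 0 -> let d := torus_row zeta z in
  forall v w, lie_brC c v w *m diag_mx d =
              lie_brC c (v *m diag_mx d) (w *m diag_mx d).
Proof.
move=> zeta0 d; apply: lie_br_diag => j k p; rewrite mxE.
have [-> | cp] := eqVneq (c j k 0 p) 0; first by rewrite mul0r mulr0.
have wjk := weight_vector_lie_br chev (weight_vector_delta chev j)
  (weight_vector_delta chev k).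
rewrite lie_br_delta in wjk; rewrite mulrC; congr (_ * _).
rewrite !mxE -expfzDr //; congr (zeta ^ _).
rewrite /torus_exp -big_split; apply: eq_bigr => i _ /=; rewrite -mulrDl.
congr (_ * _); apply: (@intr_inj R); rewrite rmorphD /= !cartan_intE.
by rewrite -pairingDl (weight_vector_coord chev wjk cp).
Qed.

Lemma torus_row_unit zeta z : zeta != 0 -> diag_mx (torus_row zeta z) \in unitmx.
Proof.
move=> zeta0; rewrite unitmxE det_diag unitfE; apply/prodf_neq0 => p _.
by rewrite mxE expfz_neq0.
Qed.

Lemma torus_row_h_set zeta z v :
  h_set v -> v *m diag_mx (torus_row zeta z) = v.
Proof.
case=> H1 [H2 ->]; apply/rowP => p; rewrite mul_mx_diag mxE [torus_row _ _ _ _]mxE.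
rewrite -[p]splitK; case: (split p) => [k | i] /=.
  by rewrite torus_exp_lshift expr0z mulr1.
by rewrite mxE !row_mxEr !mxE mul0r.
Qed.

End Torus.

(* Replacing a root by its opposite where the coefficient is negative reduces
   integer combinations to families of roots. *)
Lemma sign_character_parity (R : realType) m (neg : 'I_m -> 'I_m)
  (chi : 'I_m -> R) (b : 'I_m -> bool) (A : 'M[int]_m) :
  (forall i, chi (neg i) = chi i) -> (forall i, chi i = (-1) ^+ b i) ->
  (forall i j, A (neg i) j = - A i j) ->
  (forall w : seq 'I_m, (forall j, \sum_(i <- w) A i j = 0) ->
     \prod_(i <- w) chi i = 1) ->
  forall n : 'rV[int]_m, n *m A = 0 ->
    (2 %| (n *m (\col_i (b i)%:Z)) ord0 ord0)%Z.
Proof.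
move=> chi_neg chib Aneg triv n nA.
pose r i := if 0 <= n 0 i then i else neg i.
pose w := flatten [seq nseq (absz (n ord0 i)) (r i) | i <- enum 'I_m].
have Aw j : \sum_(i <- w) A i j = 0.
  rewrite big_flatten big_map big_enum /=.
  transitivity ((n *m A) 0 j); last by rewrite nA mxE.
  rewrite mxE; apply: eq_bigr => i _; rewrite big_nseq iter_addr_0 /r.
  have [n_ge0 | n_lt0] := lerP 0 (n 0 i).
    by rewrite -{2}(gez0_abs n_ge0) mulrC -mulr_natr natz.
  rewrite Aneg -{2}[n 0 i]opprK -(ltz0_abs n_lt0) mulNr mulrC -mulr_natr natz.
  by rewrite mulNr.
have := triv w Aw; rewrite big_flatten big_map big_enum /=.
have -> : \prod_i \prod_(j <- nseq (absz (n ord0 i)) (r i)) chi j =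
          (-1) ^+ (\sum_i b i * absz (n ord0 i))%N.
  rewrite -prodrXr; apply: eq_bigr => i _; rewrite big_nseq iter_mulr_1.
  have -> : chi (r i) = chi i by rewrite /r; case: ifP.
  by rewrite chib -exprM.
rewrite -signr_odd; case: (boolP (odd _)) => [_ /eqP | even_sum _].
  by rewrite expr1 eqNr oner_eq0.
rewrite mxE.
(* Passing from [|n_i|] back to [n_i] changes the sum by an even number, since [n_i - |n_i|] is [0]
   or [2 n_i]. *)
have -> : \sum_j n ord0 j * (\col_i (b i)%:Z) j ord0 =
   (\sum_i b i * absz (n ord0 i))%N%:Z +
   \sum_i (n ord0 i - (absz (n ord0 i))%:Z) * (b i)%:Z.
  rewrite (big_morph Posz PoszD (erefl _)) -big_split; apply: eq_bigr => i _ /=.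
  by rewrite mxE PoszM; ring.
rewrite rpredD //; first by rewrite dvdzE /= dvdn2.
apply: rpred_sum => i _; apply: dvdz_mulr.
have [n_ge0 | n_lt0] := lerP 0 (n ord0 i); first by rewrite gez0_abs // subrr.
by rewrite ltz0_abs // opprK -mulr2n -[_ *+ 2]mulr_natr natz dvdz_mull.
Qed.

(** * Conjugating the two real forms by a torus element *)

Theorem theorem4p13 (R : realType) (l m : nat)
  (c : 'I_(l + m) -> 'I_(l + m) -> 'rV[R]_(l + m))
  (rt : 'I_m -> 'rV[R]_l) (neg : 'I_m -> 'I_m) (cort : 'I_m -> 'rV[R]_l)
  (s : 'M[R]_l) (sigma1 sigma2 : 'M[R]_(l + m)) :
  chevalley_setting c rt neg cort ->
  in_I_Phi c rt s ->
  in_Inv_tau c neg sigma1 -> rho_eq sigma1 s ->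
  in_Inv_tau c neg sigma2 -> rho_eq sigma2 s ->
  (forall i, Phi_sigma_bullet rt neg s sigma1 i <-> Phi_sigma_bullet rt neg s sigma2 i) ->
  exists phi : 'M[R[i]]_(l + m),
    [/\ phi \in unitmx,
        (forall v w, lie_brC c v w *m phi = lie_brC c (v *m phi) (w *m phi)),
        maps_onto (fun v => v *m phi) (@h_set R l m) (@h_set R l m),
        maps_onto (fun v => v *m phi) (@h_s_set R l m s) (@h_s_set R l m s) &
        maps_onto (fun v => v *m phi) (g_sigma sigma2) (g_sigma sigma1)].
Proof.
move=> chev [s_inv _ /fin_all_exists[S rtS']] inv1 rho1 inv2 rho2 bullet.
have rtS i : rt (S i) = rt i *m s by rewrite rtS'.
have [eps1 [E1 sq1 neg1 S1 cortS]] := sigma_xvec chev s_inv rtS inv1 rho1.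
have [eps2 [E2 sq2 neg2 S2 _]] := sigma_xvec chev s_inv rtS inv2 rho2.
have Sneg := root_perm_neg chev rtS.
pose chi i := eps1 i * eps2 i.
have chi_sq i : chi i * chi i = 1 by rewrite /chi mulrACA -!expr2 sq1 sq2 mulr1.
have chi_neg i : chi (neg i) = chi i by rewrite /chi neg1 neg2.
have chiS i : chi (S i) = chi i by rewrite /chi S1 S2.
have chi_imag i : rt (S i) = - rt i -> chi i = 1.
  move=> rtSi; have Si : S i = neg i by apply: (rt_inj chev); rewrite rtSi (rt_neg chev).
  (* For such a root [S i = neg i], so being compact means [e i = 1]; equal sets of compact roots
     then force the signs [eps1 i] and [eps2 i] to agree. *)
  have bulletE (sg : 'M_(l + m)) (e : 'I_m -> R) :
      (forall i, xvec l i *m sg = e i *: xvec l (S i)) ->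
      Phi_sigma_bullet rt neg s sg i <-> e i = 1.
    move=> E; split=> [[_] | e1]; last first.
      by split; [rewrite /Phi_s_bullet -rtS | rewrite E e1 scale1r Si].
    rewrite E Si => /eqP; rewrite -subr_eq0 -[X in _ - X]scale1r -scalerBl scaler_eq0.
    by rewrite (negPf (xvec_neq0 _ _ _)) orbF subr_eq0 => /eqP.
  have e12 : eps1 i = 1 <-> eps2 i = 1.
    by rewrite -(bulletE _ _ E1) -(bulletE _ _ E2).
  have /eqP := sq1 i; have /eqP := sq2 i; rewrite !sqrf_eq1 /chi.
  case/orP => /eqP e2 /orP[]/eqP e1; rewrite e1 e2 ?mulr1 ?mulrNN ?mulr1 //.
    by rewrite -e1 e12.2.
  by rewrite mul1r -e2 e12.1.
have chi_add := sign_character_add chev inv1 inv2 E1 E2 sq1 sq2.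
have triv := prod_sign_character_eq1 chev s_inv rtS cortS chi_sq chiS chi_neg chi_imag chi_add.
pose b i := chi i == -1.
have chib i : chi i = (-1) ^+ b i.
  rewrite /b; have /eqP := chi_sq i; rewrite -expr2 sqrf_eq1.
  by case/orP => /eqP->; rewrite ?eqxx // eq_sym eqNr oner_eq0.
pose C (i j : 'I_m) := cartan_int rt cort (rshift l i) j.
have CE i j : (C i j)%:~R = pairing (rt i) (cort j).
  by rewrite /C (cartan_intE chev) weight_rshift.
pose A : 'M[int]_m := \matrix_(i, j) (C i j + C (S i) j).
have AE i j : (A i j)%:~R = pairing (rt i + rt (S i)) (cort j).
  by rewrite mxE rmorphD /= !CE pairingDl.
have Aneg i j : A (neg i) j = - A i j.
  apply: (@intr_inj R); rewrite rmorphN /= !AE Sneg !(rt_neg chev) -opprD.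
  by rewrite pairingNl.
have Atriv (w : seq 'I_m) :
    (forall j, \sum_(i <- w) A i j = 0) -> \prod_(i <- w) chi i = 1.
  move=> Aw; apply: triv => j; have := congr1 (intmul (1 : R)) (Aw j).
  by rewrite rmorph_sum /=; under eq_bigr do rewrite AE.
have [N [z [w [N_gt0 Az]]]] :=
  int_parity_solvable (sign_character_parity chi_neg chib Aneg Atriv).
have [zeta [zeta0 zetaN zetaJ]] := exists_unitary_root_opp1 R N_gt0.
pose E i := torus_exp rt cort z (rshift l i).
(* Row [i] of [Az] makes the exponent [N (b_i + 2 w_i)]; as [zeta ^ N = -1], the power is
   [(-1) ^ b_i], which is [chi i]. *)
have Ezeta i : zeta ^ (E i + E (S i)) = cR (chi i).
  have -> : E i + E (S i) = N%:Z * ((b i)%:Z + 2%:Z * w i 0).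
    have /colP/(_ i) := Az; rewrite !mxE => <-; rewrite /E /torus_exp -big_split.
    by apply: eq_bigr => j _; rewrite mxE /= mulrDl.
  rewrite -exprz_exp -exprnP zetaN expfzDr ?oppr_eq0 ?oner_eq0 //.
  rewrite -exprz_exp -[(-1) ^ 2%:Z]exprnP sqrrN expr1n exp1rz mulr1 chib -exprnP.
  by case: (b i); rewrite ?expr0 ?expr1 //; apply/eqP; rewrite eq_complex /= oppr0 !eqxx.
pose d := torus_row rt cort zeta z; have uphi := torus_row_unit rt cort z zeta0.
have fix_h := @torus_row_h_set R l m rt cort zeta z.
exists (diag_mx d); split=> //; first exact: (torus_row_lie_br chev).
- by split=> v hv; rewrite ?fix_h //; exists v; rewrite fix_h.
- have hs_h (v : 'rV[R[i]]_(l + m)) : h_s_set s v -> h_set v.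
    by case=> H1 [H2 [_ _ ->]]; exists H1, H2.
  split=> v hv; first by rewrite fix_h //; apply: hs_h.
  by exists v; split=> //; apply: fix_h; apply: hs_h.
apply: maps_onto_g_sigma => //.
(* Compared entrywise: on Cartan rows both involutions act by [s^T] and the torus by 1. On the row
   of a root [a] only the column of [s a] matters, where [conj(t(a)) eps1(a) = eps2(a) t(s a)]
   follows from [t(a) t(s a) = chi(a)] and [eps2(a)^2 = 1]. *)
rewrite map_diag_mx mul_mx_diag mul_diag_mx; apply/matrixP => p q; rewrite !mxE.
rewrite -[p]splitK; case: (split p) => [k | i] /=.
  rewrite torus_exp_lshift expr0z conjc1 mul1r.
  rewrite (sigma_coord_hvec inv1 rho1) (sigma_coord_hvec inv2 rho2).
  rewrite -[q]splitK; case: (split q) => [k' | i'] /=.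
    by rewrite torus_exp_lshift expr0z mulr1.
  by rewrite /hvec row_mxEr mxE mul0r.
rewrite (sigma_coord_xvec _ (E1 i)) (sigma_coord_xvec _ (E2 i)).
have [-> | _] := eqVneq q; last by rewrite !mulr0 mul0r.
rewrite !mulr1 -/(E i) -/(E (S i)).
have -> : conjc (zeta ^ E i) = (zeta ^ E i)^-1.
  by rewrite fmorphXz /= zetaJ expfV.
have zE0 : zeta ^ E i != 0 by rewrite expfz_neq0.
apply: (mulfI zE0); rewrite mulrA divff // mul1r mulrCA -expfzDr // Ezeta.
rewrite /chi /cR; apply/eqP; rewrite eq_complex /= !mul0r !mulr0 addr0 subr0 eqxx andbT.
by rewrite mulrCA -expr2 sq2 mulr1.
Qed.
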